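(* Let $m_1,m_2,n_1,n_2,n$ be positive integers with $m_1+m_2=n_1+n_2$, $m_1\ge n_1$ and $m_1\ge m_2$, and suppose $$\mathcal{Q}=\begin{bmatrix}\mathcal{Q}_{11}&\mathcal{Q}_{12}\\ \mathcal{Q}_{21}&\mathcal{Q}_{22}\end{bmatrix}\in\mathbb{R}^{(m_1+m_2)\times(n_1+n_2)\times n}$$ is an orthogonal tensor, where $\mathcal{Q}_{ij}\in\mathbb{R}^{m_i\times n_j\times n}$. Define the nonnegative integers $p=\max\{0,n_1-m_2\}$ and $q=\max\{0,m_2-n_1\}$. Then there exist orthogonal tensors $\mathcal{U}\in\mathbb{R}^{m_1\times m_1\times n}$, $\mathcal{V}\in\mathbb{R}^{m_2\times m_2\times n}$, $\mathcal{W}\in\mathbb{R}^{n_1\times n_1\times n}$ and $\mathcal{Z}\in\mathbb{R}^{n_2\times n_2\times n}$ such that $$\begin{bmatrix}\mathcal{U}&\mathcal{O}\\ \mathcal{O}&\mathcal{V}\end{bmatrix}^{\mathrm T}*\mathcal{Q}*\begin{bmatrix}\mathcal{W}&\mathcal{O}\\ \mathcal{O}&\mathcal{Z}\end{bmatrix}=\mathcal{D}=\begin{bmatrix}\mathcal{I}&\mathcal{O}&\mathcal{O}&\mathcal{O}&\mathcal{O}\\ \mathcal{O}&\mathcal{C}&\mathcal{S}&\mathcal{O}&\mathcal{O}\\ \mathcal{O}&\mathcal{O}&\mathcal{O}&\mathcal{O}&\mathcal{I}\\ \mathcal{O}&\mathcal{S}&-\mathcal{C}&\mathcal{O}&\mathcal{O}\\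 \mathcal{O}&\mathcal{O}&\mathcal{O}&\mathcal{I}&\mathcal{O}\end{bmatrix},$$ where the block rows of $\mathcal{D}$ have, from top to bottom, sizes $p,\ n_1-p,\ m_1-n_1,\ n_1-p,\ q$, the block columns have, from left to right, sizes $p,\ n_1-p,\ n_1-p,\ q,\ m_1-n_1$ (blocks with a zero dimension being absent), each $\mathcal{I}$ is an identity tensor and each $\mathcal{O}$ a zero tensor of the corresponding size, and $\mathcal{C},\mathcal{S}\in\mathbb{R}^{(n_1-p)\times(n_1-p)\times n}$ are f-diagonal tensors satisfying $$\mathcal{C}^{\mathrm T}*\mathcal{C}+\mathcal{S}^{\mathrm T}*\mathcal{S}=\mathcal{I}.$$
   Context: All tensors are third-order arrays. For $\mathcal{A}\in\mathbb{R}^{n_1\times n_2\times n_3}$, the frontal slices are the matrices $A_k=\mathcal{A}(:,:,k)\in\mathbb{R}^{n_1\times n_2}$, $k=1,\dots,n_3$. $\mathrm{unfold}(\mathcal{A})$ is the $n_1n_3\times n_2$ matrix obtained by stacking $A_1,\dots,A_{n_3}$ vertically, $\mathrm{fold}$ is its inverse operation, and $\mathrm{bcirc}(\mathcal{A})$ is the $n_1n_3\times n_2n_3$ block circulant matrix whose $(i,j)$ block is $A_{((i-j)\bmod n_3)+1}$ (so its first block column is $\mathrm{unfold}(\mathcal{A})$). T-product: for $\mathcal{A}\in\mathbb{R}^{n_1\times n_2\times n_3}$ and $\mathcal{B}\in\mathbb{R}^{n_2\times r\times n_3}$, $\mathcal{A}*\mathcal{B}=\mathrm{fold}(\mathrm{bcirc}(\mathcal{A})\cdot\mathrm{unfold}(\mathcal{B}))\in\mathbb{R}^{n_1\times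 r\times n_3}$. Transpose: $\mathcal{A}^{\mathrm T}\in\mathbb{R}^{n_2\times n_1\times n_3}$ is obtained by transposing each frontal slice and then reversing the order of the transposed slices $2$ through $n_3$. Identity tensor: $\mathcal{I}\in\mathbb{R}^{m\times m\times \ell}$ has first frontal slice the $m\times m$ identity matrix and all other frontal slices zero. A tensor $\mathcal{Q}\in\mathbb{R}^{m\times m\times\ell}$ is orthogonal if $\mathcal{Q}^{\mathrm T}*\mathcal{Q}=\mathcal{Q}*\mathcal{Q}^{\mathrm T}=\mathcal{I}$. (In particular an orthogonal tensor has square frontal slices.) A tensor is f-diagonal if each of its frontal slices is a diagonal matrix. A block tensor is the tensor whose $k$-th frontal slice is the block matrix formed from the $k$-th frontal slices of the blocks. *)

(* Defs.v *)
From mathcomp Require Import all_boot all_order all_algebra zify.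

Set Implicit Arguments.
Unset Strict Implicit.
Unset Printing Implicit Defensive.

Import GRing.Theory.
Local Open Scope ring_scope.

(* A third-order m x n x l tensor is the family of its frontal slices, numbered
   from 0 (the slice A k here is the usual A_(k+1)). The pointwise zero, sum and
   opposite come from the zmodType structure on finite functions.

   Operations that reduce slice indices modulo the third dimension are defined
   for a dimension of the form l.+1, where 'I_l.+1 is the group of integers
   modulo l.+1: i - j and - k below are computed modulo l.+1. *)
Notation tensor R m n l := {ffun 'I_l -> 'M[R]_(m, n)}.

Section Tensor.

Variable R : nzRingType.

Definition unfoldt m n l (A : tensor R m n l) : 'M[R]_(\sum_(k < l) m, n) :=
  \mxcol_(k < l) A k.

Definition foldt m n l (M : 'M[R]_(\sum_(k < l) m, n)) : tensor R m n l :=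
  [ffun k => submxcol M k].

Definition bcirc m n l (A : tensor R m n l.+1) :
    'M[R]_(\sum_(i < l.+1) m, \sum_(j < l.+1) n) :=
  \mxblock_(i < l.+1, j < l.+1) A (i - j).

Definition tprod m n r l (A : tensor R m n l.+1) (B : tensor R n r l.+1) :
    tensor R m r l.+1 :=
  foldt (bcirc A *m unfoldt B).

(* Reversing the order of the slices 1, ..., l fixes slice 0 and puts slice
   l.+1 - k at position k > 0; both cases read - k in 'I_l.+1. *)
Definition ttr m n l (A : tensor R m n l.+1) : tensor R n m l.+1 :=
  [ffun k => (A (- k))^T].

Definition tid m l : tensor R m m l.+1 :=
  [ffun k => if k == 0 then 1%:M else 0].

Definition orthogonalt m l (Q : tensor R m m l.+1) : Prop :=
  tprod (ttr Q) Q = tid m l /\ tprod Q (ttr Q) = tid m l.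

Definition fdiagonal m n l (A : tensor R m n l) : Prop :=
  forall k, is_diag_mx (A k).

Definition rowt m n1 n2 l (A : tensor R m n1 l) (B : tensor R m n2 l) :
    tensor R m (n1 + n2) l :=
  [ffun k => row_mx (A k) (B k)].

Definition colt m1 m2 n l (A : tensor R m1 n l) (B : tensor R m2 n l) :
    tensor R (m1 + m2) n l :=
  [ffun k => col_mx (A k) (B k)].

Definition blockt m1 m2 n1 n2 l
    (A11 : tensor R m1 n1 l) (A12 : tensor R m1 n2 l)
    (A21 : tensor R m2 n1 l) (A22 : tensor R m2 n2 l) :
    tensor R (m1 + m2) (n1 + n2) l :=
  [ffun k => block_mx (A11 k) (A12 k) (A21 k) (A22 k)].

Definition castt m n m' n' l (eq_mn : (m = m') * (n = n')) (A : tensor R m n l) :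
    tensor R m' n' l :=
  [ffun k => castmx eq_mn (A k)].

Definition csd_tensor p s t q l (C S : tensor R s s l.+1) :
    tensor R (p + (s + (t + (s + q)))) (p + (s + (s + (q + t)))) l.+1 :=
  colt (rowt (tid p l) (rowt 0 (rowt   0   (rowt     0     0))))
 (colt (rowt     0     (rowt C (rowt   S   (rowt     0     0))))
 (colt (rowt     0     (rowt 0 (rowt   0   (rowt     0     (tid t l)))))
 (colt (rowt     0     (rowt S (rowt (- C) (rowt     0     0))))
       (rowt     0     (rowt 0 (rowt   0   (rowt (tid q l) 0))))))).

End Tensor.

Notation "A *t B" := (tprod A B) (at level 40, left associativity) : ring_scope.

(* The two sides of these identities are the sizes of csd_tensor p s t q and of
   the block tensor it is compared with, for p = max(0, n1 - m2), s = n1 - p,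
   t = m1 - n1 and q = max(0, m2 - n1); subtraction on nat is truncated. *)
Lemma csd_row_dim m1 m2 n1 (p := (n1 - m2)%N) (q := (m2 - n1)%N) :
  (n1 <= m1)%N ->
  (p + ((n1 - p) + ((m1 - n1) + ((n1 - p) + q))))%N = (m1 + m2)%N.
Proof. by rewrite /p /q; lia. Qed.

Lemma csd_col_dim m1 m2 n1 n2 (p := (n1 - m2)%N) (q := (m2 - n1)%N) :
  (m1 + m2)%N = (n1 + n2)%N -> (n1 <= m1)%N ->
  (p + ((n1 - p) + ((n1 - p) + (q + (m1 - n1)))))%N = (n1 + n2)%N.
Proof. by rewrite /p /q; lia. Qed.

(* Main.v *)
Require Import Defs.
From mathcomp Require Import all_boot all_order all_algebra reals.
From mathcomp Require Import boolp classical_sets topology normedtype derive.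
From mathcomp Require Import ring lra zify.

(* Tensors are identified with real block circulant matrices, i.e. with the
   real matrices commuting with the cyclic block shifts. The group of orthogonal
   matrices commuting with a given family of orthogonal matrices is compact, so
   that the function tr (J W^T H W) + tr (X^T W) of W reaches its maximum on it;
   moving away from a maximum along Cayley transforms of skew-symmetric matrices
   of the commutant shows that 2 J W^T H W + X^T W is then symmetric. For X = 0
   and J diagonal with distinct weights this diagonalizes H, and for J = H = 0
   it is (up to signs) the polar decomposition of X; both hold inside the
   commutant, hence for tensors, and no Fourier transform is needed.
   As in the matrix case, a singular value decomposition of Q21 followed by a
   polar decomposition of Q11 W gives U, V, W and the first block column of D.
   The second block column F of D is also an orthonormal complement of the first,
   so that Z is the coordinate tensor of F in the second block column of
   diag(U, V)^T Q. *)

Set Implicit Arguments.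
Unset Strict Implicit.
Unset Printing Implicit Defensive.

Import Order.TTheory GRing.Theory Num.Theory.
Import numFieldNormedType.Exports.

Local Open Scope ring_scope.

(** * Continuity and closedness for matrix-valued functions *)

Section MatrixContinuity.

Variables (R : realType) (T : topologicalType).

Definition mx_continuous m n (F : T -> 'M[R]_(m, n)) :=
  forall i j, continuous (fun x => F x i j).

Lemma continuous_sum_ord n (f : 'I_n -> T -> R) :
  (forall k, continuous (f k)) -> continuous (fun x => \sum_k f k x).
Proof.
move=> cf; elim: (index_enum _) => [|k r IHr].
  by under eq_fun do rewrite big_nil; apply: cst_continuous.
under eq_fun do rewrite big_cons.
by move=> x; apply: continuousD; [apply: cf | apply: IHr].
Qed.

Lemma mx_continuous_cst m n (A : 'M[R]_(m, n)) : mx_continuous (fun _ => A).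
Proof. by move=> i j; apply: cst_continuous. Qed.

Lemma mx_continuousD m n (F G : T -> 'M[R]_(m, n)) :
  mx_continuous F -> mx_continuous G -> mx_continuous (fun x => F x + G x).
Proof.
move=> cF cG i j; under eq_fun do rewrite mxE.
by move=> x; apply: continuousD; [apply: cF | apply: cG].
Qed.

Lemma mx_continuous_tr m n (F : T -> 'M[R]_(m, n)) :
  mx_continuous F -> mx_continuous (fun x => (F x)^T).
Proof. by move=> cF i j; under eq_fun do rewrite mxE; apply: cF. Qed.

Lemma mx_continuousM m n p (F : T -> 'M[R]_(m, n)) (G : T -> 'M[R]_(n, p)) :
  mx_continuous F -> mx_continuous G -> mx_continuous (fun x => F x *m G x).
Proof.
move=> cF cG i j; under eq_fun do rewrite mxE.
apply: continuous_sum_ord => k x.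
by apply: continuousM; [apply: cF | apply: cG].
Qed.

Lemma continuous_mxtrace n (F : T -> 'M[R]_n) :
  mx_continuous F -> continuous (fun x => \tr (F x)).
Proof. by move=> cF; apply: continuous_sum_ord => k; apply: cF. Qed.

Lemma closed_mx_eq m n (F G : T -> 'M[R]_(m, n)) :
  mx_continuous F -> mx_continuous G -> closed [set x | F x = G x]%classic.
Proof.
move=> cF cG.
rewrite (_ : [set _ | _]%classic = \bigcap_(ij in [set: 'I_m * 'I_n])
   ((fun x => F x ij.1 ij.2 - G x ij.1 ij.2) @^-1` [set y | y = 0]))%classic.
  apply: closed_bigI => -[i j] _ /=; apply: preimage_closed; last exact: closed_eq.
  by move=> x _; apply: continuousB; [apply: cF | apply: cG].
apply/seteqP; split=> x /=.
  by move=> e [i j] _ /=; rewrite e subrr.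
move=> h; apply/matrixP => i j; apply/eqP; rewrite -subr_eq0; apply/eqP.
exact: (h (i, j)).
Qed.

End MatrixContinuity.

Lemma mx_continuous_vec_mx (R : realType) m n :
  mx_continuous (fun x : 'rV[R]_(m * n) => vec_mx x).
Proof.
by move=> i j; under eq_fun do rewrite mxE; apply: coord_continuous.
Qed.

(** * Maximization over the compact group of orthogonal matrices in a commutant *)

Section OrthogonalCommutant.

Variables (R : realType) (d : nat) (I : Type) (g : I -> 'M[R]_d).

Definition commutant (X : 'M[R]_d) := forall i, g i *m X = X *m g i.

Definition orth_commutant (W : 'M[R]_d) := W^T *m W = 1%:M /\ commutant W.

(** The columns of [W] are unit vectors; this is the boundedness half of compactness. *)
Lemma orth_entry_le1 (W : 'M[R]_d) i j : W^T *m W = 1%:M -> `|W i j| <= 1.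
Proof.
move=> /matrixP/(_ j j); rewrite !mxE eqxx mulr1n => e.
rewrite -(@ler_pXn2r _ 2) ?nnegrE // expr1n -normrX ger0_norm ?sqr_ge0 //.
rewrite -e (bigD1 i) //= mxE -expr2 lerDl.
by apply: sumr_ge0 => k _; rewrite mxE -expr2 sqr_ge0.
Qed.

Lemma commutant1 : commutant 1%:M.
Proof. by move=> i; rewrite mulmx1 mul1mx. Qed.

(** Extreme value theorem: the constraints are matrix equations, hence closed, and the entries lie
    in [[-1, 1]]. Matrices are read as row vectors, so that compactness is that of a product of
    segments. *)
Lemma orth_commutant_max (f : 'M[R]_d -> R) :
  continuous (fun x : 'rV[R]_(d * d) => f (vec_mx x)) ->
  exists2 W, orth_commutant W & forall V, orth_commutant V -> f V <= f W.
Proof.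
move=> cf.
have cv := @mx_continuous_vec_mx R d d.
pose A := [set x : 'rV[R]_(d * d) | orth_commutant (vec_mx x)]%classic.
have A_closed : closed A.
  rewrite (_ : A = [set x | (vec_mx x)^T *m vec_mx x = 1%:M] `&`
     \bigcap_(i in setT) [set x | g i *m vec_mx x = vec_mx x *m g i])%classic.
    apply: closedI; last (apply: closed_bigI => i _);
      apply: closed_mx_eq => //; repeat first [exact: mx_continuous_cst |
        exact: cv | apply: mx_continuousM | apply: mx_continuous_tr].
  by apply/seteqP; split=> x /= [? h]; split=> // i; [move=> _|]; apply: h.
have A_compact : compact A.
  have := @rV_compact R _ (fun _ : 'I_(d * d) => `[- 1, 1]%classic).
  move=> /(_ (fun=> @segment_compact _ _ _)) cK.
  apply: subclosed_compact A_closed cK _ => x [ox _] k /=.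
  case/mxvec_indexP: k => i j; rewrite in_itv /= -ler_norml.
  by have := orth_entry_le1 i j ox; rewrite mxE.
have A0 : (A !=set0)%classic.
  exists (mxvec 1%:M); rewrite /A /= mxvecK.
  by split; [rewrite trmx1 mulmx1 | exact: commutant1].
have [c Ac maxc] := compact_EVT_max A0 A_compact (continuous_subspaceT cf).
exists (vec_mx c); first by move: Ac; rewrite inE.
move=> V oV; rewrite -[V]mxvecK; apply: maxc.
by rewrite inE /A /= mxvecK.
Qed.

End OrthogonalCommutant.

(** * Orthogonal matrices in a commutant *)

Section FrobeniusNorm.

Variable R : realType.

Lemma mxtrace_tr_mul m n (A : 'M[R]_(m, n)) :
  \tr (A^T *m A) = \sum_i \sum_j A i j ^+ 2.
Proof.
rewrite exchange_big; apply: eq_bigr => j _; rewrite mxE.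
by apply: eq_bigr => i _; rewrite mxE expr2.
Qed.

(** The trace is a sum of squares. An upper bound suffices as hypothesis, and it is what maximality
    provides. *)
Lemma mxtrace_tr_mul_le0 m n (A : 'M[R]_(m, n)) : \tr (A^T *m A) <= 0 -> A = 0.
Proof.
rewrite mxtrace_tr_mul => le0; apply/matrixP => i j; rewrite mxE.
have sq_ge0 k : 0 <= \sum_l A k l ^+ 2 by apply: sumr_ge0 => l _; exact: sqr_ge0.
have /eqP : \sum_k \sum_l A k l ^+ 2 = 0.
  by apply/eqP; rewrite eq_le le0 sumr_ge0.
rewrite psumr_eq0 // => /allP/(_ i (mem_index_enum i))/=.
rewrite psumr_eq0 => [|l _]; last exact: sqr_ge0.
by move=> /allP/(_ j (mem_index_enum j))/=; rewrite sqrf_eq0 => /eqP.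
Qed.

Lemma tr_mul_eq0 m n (A : 'M[R]_(m, n)) : A^T *m A = 0 -> A = 0.
Proof. by move=> e; apply: mxtrace_tr_mul_le0; rewrite e mxtrace0. Qed.

End FrobeniusNorm.

(** * Critical points of the trace functional, via Cayley transforms *)

Section CriticalPoints.

Variables (R : realType) (d : nat) (I : Type) (g : I -> 'M[R]_d).
Hypothesis g_orth : forall i, (g i)^T *m g i = 1%:M.

Local Notation commutant := (commutant g).
Local Notation orth_commutant := (orth_commutant g).

Lemma commutantM A B : commutant A -> commutant B -> commutant (A *m B).
Proof. by move=> cA cB i; rewrite mulmxA cA -mulmxA cB mulmxA. Qed.

Lemma commutantD A B : commutant A -> commutant B -> commutant (A + B).
Proof. by move=> cA cB i; rewrite mulmxDr mulmxDl cA cB. Qed.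

Lemma commutantZ a A : commutant A -> commutant (a *: A).
Proof. by move=> cA i; rewrite -scalemxAr -scalemxAl cA. Qed.

Lemma commutantN A : commutant A -> commutant (- A).
Proof. by move=> cA i; rewrite mulmxN mulNmx cA. Qed.

(** Transposing shows that [A^T] commutes with [(g i)^T], which is the inverse of [g i] by
    orthogonality. *)
Lemma commutant_tr A : commutant A -> commutant A^T.
Proof.
move=> cA i; have gg : g i *m (g i)^T = 1%:M by apply: mulmx1C; apply: g_orth.
have := congr1 trmx (cA i); rewrite !trmx_mul => e.
by rewrite -[LHS]mulmx1 -(g_orth i) -mulmxA [A^T *m _]mulmxA e !mulmxA gg mul1mx.
Qed.

Lemma commutant_inv A : commutant A -> commutant (invmx A).
Proof.
move=> cA i; have [uA|nuA] := boolP (A \in unitmx); last first.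
  by rewrite /invmx (negPf nuA).
by rewrite -[g i *m _](mulKmx uA) [A *m (_ *m _)]mulmxA -cA -mulmxA mulmxV // mulmx1.
Qed.

Lemma orth_commutantM A B :
  orth_commutant A -> orth_commutant B -> orth_commutant (A *m B).
Proof.
move=> [oA cA] [oB cB]; split; last exact: commutantM.
by rewrite trmx_mul -mulmxA (mulmxA A^T) oA mul1mx.
Qed.

(* C is the Cayley transform (1 - K)^-1 (1 + K). *)
Lemma cayley_transform K : commutant K -> K^T = - K ->
  exists2 C, orth_commutant C & C = 1%:M + K *m (C + 1%:M).
Proof.
move=> cK skewK; pose B := 1%:M - K.
have trB : B^T = 1%:M + K by rewrite linearB /= trmx1 skewK opprK.
have uB : B \in unitmx.
  (* If [v = v K] with [K] skew-symmetric, then [v v^T = - v v^T], so [v] has norm zero: the kernel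
     of [1 - K] is trivial. *)
  rewrite unitmxE unitfE; apply/negP => /det0P[v v0].
  rewrite mulmxBr mulmx1 => /eqP; rewrite subr_eq0 => /eqP vK.
  case/eqP: v0; suff vv : v *m v^T = 0.
    by apply: trmx_inj; rewrite trmx0; apply: tr_mul_eq0; rewrite trmxK.
  have e : v *m v^T = - (v *m v^T).
    by rewrite {1}vK -mulmxA -[K]trmxK -trmx_mul skewK mulmxN linearN /= -vK mulmxN.
  by apply/matrixP => i j; have := congr1 (fun M : 'M_1 => M i j) e; rewrite !mxE; lra.
have uBT : B^T \in unitmx by rewrite unitmx_tr.
have BBT : B *m B^T = B^T *m B.
  by rewrite trB mulmxDr mulmxDl mulmx1 mul1mx mulmxBl mulmxBr mulmx1 mul1mx.
have cB : commutant B by apply: commutantD (commutantN cK); exact: commutant1.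
exists (invmx B *m B^T).
  split; last by apply: commutantM; [apply: commutant_inv | apply: commutant_tr].
  rewrite trmx_mul trmxK trmx_inv mulmxA -(mulmxA B).
  suff -> : invmx B^T *m invmx B = invmx B *m invmx B^T.
    by rewrite mulmxA mulmxV // mul1mx mulVmx.
  apply: (can_inj (mulKmx uBT)); apply: (can_inj (mulKmx uB)).
  by rewrite mulKVmx // mulmxV // mulmxA BBT -mulmxA mulKVmx // mulmxV.
(* Expanding [B C = B^T] gives a fixed-point equation for [C] free of inverses, from which
   expansions in [K] are read off. *)
have : B *m (invmx B *m B^T) = B^T by rewrite mulKVmx.
move: (invmx B *m B^T) => C; rewrite /B mulmxBl mul1mx trB => /eqP.
by rewrite subr_eq => /eqP {1}->; rewrite mulmxDr mulmx1 -addrA [K + _]addrC.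
Qed.

(* If Y is not symmetric, then K = Y^T - Y is a skew-symmetric direction of the
   commutant along which the derivative tr (Y K) is positive at the maximum. *)
Lemma critical_point J H X :
  commutant J -> commutant H -> commutant X -> J^T = J -> H^T = H ->
  exists2 W, orth_commutant W &
    let Y := 2 *: (J *m (W^T *m H *m W)) + X^T *m W in Y^T = Y.
Proof.
move=> cJ cH cX symJ symH.
have cv := @mx_continuous_vec_mx R d d.
have [|W oW maxW] := @orth_commutant_max R d I g
    (fun W => \tr (J *m (W^T *m H *m W) + X^T *m W)).
  apply: continuous_mxtrace.
  by repeat first [exact: mx_continuous_cst | exact: cv |
    apply: mx_continuousD | apply: mx_continuousM | apply: mx_continuous_tr].
exists W => //=; have [_ cW] := oW.
set H' := W^T *m H *m W; set N := X^T *m W; set Y := 2 *: (J *m H') + N.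
have cWT := commutant_tr cW.
have symH' : H'^T = H' by rewrite /H' !trmx_mul trmxK symH mulmxA.
have cY : commutant Y.
  by apply: commutantD; [apply: commutantZ|];
     repeat first [assumption | apply: commutantM | apply: commutant_tr].
pose K := Y^T - Y.
have cK : commutant K by apply: commutantD (commutantN cY); exact: commutant_tr.
have skewK : K^T = - K by rewrite /K linearB /= trmxK opprB.
pose E C := K *m (C + 1%:M).
pose psi C := \tr (Y *m K *m E C + J *m ((E C)^T *m H' *m E C)).
(* A maximum of [- psi] bounds [psi] below by a constant independent of the step size [t]. *)
have [|C0 _ minC0] := @orth_commutant_max R d I g (fun C => - psi C).
  move=> x; apply: (@continuousN R R _ (fun x => psi (vec_mx x))).
  move: x; apply: continuous_mxtrace; rewrite /E.
  by repeat first [exact: mx_continuous_cst | exact: cv |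
    apply: mx_continuousD | apply: mx_continuousM | apply: mx_continuous_tr].
have trYK : \tr (K^T *m K) = 2 * \tr (Y *m K).
  rewrite skewK {1}/K opprB mulmxBl !mulmxBr !linearB /= (mxtrace_mulC Y^T Y).
  rewrite -[\tr (Y^T *m Y^T)]mxtrace_tr trmx_mul trmxK mulrBr; ring.
(* The Cayley transform C of t K is 1 + t E C, so maximality at C reads
   t |K|^2 + t^2 psi C <= 0, and psi is bounded below by compactness. *)
have small t : 0 < t -> \tr (K^T *m K) <= t * - psi C0.
  move=> t0.
  have [||C oC defC] := @cayley_transform (t *: K).
  - exact: commutantZ.
  - by rewrite linearZ /= skewK scalerN.
  have /= := maxW _ (orth_commutantM oW oC); have := minC0 _ oC.
  rewrite lerN2 => le_psi.
  have defF : C = 1%:M + t *: E C by rewrite {1}defC /E scalemxAl.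
  (* Substituting the fixed-point equation into itself isolates the first-order term [2 K] of
     [E C]. *)
  have defE : E C = 2 *: K + t *: (K *m E C).
    by rewrite {1}/E {1}defC -scalemxAl addrAC mulmxDr mulmxDr mulmx1 -scalemxAr
       scaler_nat mulr2n.
  (* Expansion of the objective at [W C] in powers of [t]. Symmetry of [J] and [H'] makes the two
     linear terms coming from [H] equal, so that the linear part is [tr (Y E)]. *)
  rewrite [X in X <= _](_ : _ = \tr (J *m H' + N) + t * \tr (Y *m E C) +
     t ^+ 2 * \tr (J *m ((E C)^T *m H' *m E C))); last first.
    have -> : (W *m C)^T *m H *m (W *m C) = C^T *m H' *m C.
      by rewrite trmx_mul /H' !mulmxA.
    rewrite (mulmxA X^T) -/N; move: (E C) defF => F ->.
    have -> : (1%:M + t *: F)^T = 1%:M + t *: F^T by rewrite linearD linearZ /= trmx1.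
    rewrite !(mulmxDl, mulmxDr, mulmx1, mul1mx, =^~ scalemxAl, =^~ scalemxAr).
    rewrite !(mxtraceD, mxtraceZ).
    have -> : \tr (J *m (F^T *m H')) = \tr (J *m (H' *m F)).
      by rewrite -mxtrace_tr trmx_mul trmx_mul trmxK symH' symJ -mxtrace_mulC.
    by rewrite mulmxA; ring.
  have -> : \tr (Y *m E C) = \tr (K^T *m K) + t * \tr (Y *m K *m E C).
    rewrite {1}defE mulmxDr -!scalemxAr mxtraceD !mxtraceZ trYK mulmxA; ring.
  rewrite -/H' -/N => le_max.
  have le_t : t * (\tr (K^T *m K) + t * psi C) <= 0.
    by rewrite /psi mxtraceD; lra.
  rewrite pmulr_rle0 // in le_t.
  have := ler_wpM2l (ltW t0) le_psi; rewrite mulrN; lra.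
suff K0 : K = 0 by apply/eqP; rewrite -subr_eq0; apply/eqP.
apply: mxtrace_tr_mul_le0.
move: (psi C0) (\tr (K^T *m K)) small => b a small.
rewrite leNgt; apply/negP => a_gt0.
have [b_ge0|b_lt0] := leP 0 b.
  by have := small 1 ltr01; rewrite mul1r; lra.
(* For [b < 0] this value of [t] turns the bound into [a <= a / 2]. *)
have := small (a / (- b * 2)).
rewrite divr_gt0 ?mulr_gt0 ?oppr_gt0 // => /(_ isT).
have -> : a / (- b * 2) * - b = a / 2 by field; rewrite lt_eqF.
lra.
Qed.

End CriticalPoints.

(** * Spectral theorem and polar decomposition inside a commutant *)

Section SpectralTheorem.

Variables (R : realType) (d : nat).

(** At the critical point for [X = 0] the product of the symmetric matrices [J] and [W^T H W] is
    symmetric, which means that they commute. *)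
Lemma orth_commutant_eigen (I : Type) (g : I -> 'M[R]_d) J H :
  (forall i, (g i)^T *m g i = 1%:M) -> commutant g J -> commutant g H ->
  J^T = J -> H^T = H ->
  exists2 W, orth_commutant g W &
    (W^T *m H *m W) *m J = J *m (W^T *m H *m W).
Proof.
move=> og cJ cH symJ symH.
have c0 : commutant g 0 by move=> i; rewrite mulmx0 mul0mx.
have [W oW /=] := critical_point og cJ cH c0 symJ symH.
rewrite trmx0 mul0mx addr0 linearZ /= => /(scalerI _) e.
exists W => //; rewrite -e; last by rewrite pnatr_eq0.
by rewrite trmx_mul symJ !trmx_mul trmxK symH !mulmxA.
Qed.

(** The family is reduced to the identity, so that its commutant is everything; commuting with a
    diagonal matrix of distinct weights forces diagonality. *)
Lemma spectral_real (H : 'M[R]_d) : H^T = H ->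
  exists2 O : 'M_d, O^T *m O = 1%:M & exists a, H = O *m diag_mx a *m O^T.
Proof.
move=> symH; pose J : 'M[R]_d := diag_mx (\row_i i%:R).
have [|||||W [oW _]] := @orth_commutant_eigen unit (fun=> 1%:M) J H.
- by move=> _; rewrite trmx1 mulmx1.
- by move=> i; rewrite mul1mx mulmx1.
- by move=> i; rewrite mul1mx mulmx1.
- by rewrite tr_diag_mx.
- exact: symH.
set D := W^T *m H *m W => DJ.
have /diag_mxP[a defD] : is_diag_mx D.
  apply/is_diag_mxP => i j neq_ij; have := congr1 (fun M : 'M_d => M i j) DJ.
  rewrite mul_mx_diag mul_diag_mx !mxE mulrC => /eqP.
  rewrite -subr_eq0 -mulrBl mulf_eq0 subr_eq0 eqr_nat => /orP[|/eqP //].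
  by rewrite eq_sym (negPf neq_ij).
exists W => //; exists a; rewrite -defD /D !mulmxA.
have WWt : W *m W^T = 1%:M by apply: mulmx1C.
by rewrite WWt mul1mx -mulmxA WWt mulmx1.
Qed.

Lemma orth_mulKmx (O : 'M[R]_d) k : O^T *m O = 1%:M ->
  cancel (mulmx O : 'M_(d, k) -> _) (mulmx O^T).
Proof. by move=> oO A; rewrite mulmxA oO mul1mx. Qed.

Lemma mul_orth_diag (O : 'M[R]_d) a b : O^T *m O = 1%:M ->
  (O *m diag_mx a *m O^T) *m (O *m diag_mx b *m O^T) =
  O *m diag_mx (\row_i (a 0 i * b 0 i)) *m O^T.
Proof.
by move=> oO; rewrite -!mulmxA orth_mulKmx // (mulmxA (diag_mx a)) mulmx_diag.
Qed.

Lemma tr_orth_diag (O : 'M[R]_d) a :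
  (O *m diag_mx a *m O^T)^T = O *m diag_mx a *m O^T.
Proof. by rewrite !trmx_mul trmxK tr_diag_mx mulmxA. Qed.

(** Functional calculus: the hypothesis says that [b] is a function of [a]. In the basis [O],
    commuting with the first matrix means that entry [(i, j)] vanishes unless [a 0 i = a 0 j]. *)
Lemma orth_diag_commute (O : 'M[R]_d) (a b : 'rV_d) (Y : 'M_d) : O^T *m O = 1%:M ->
  (forall i j, a 0 i = a 0 j -> b 0 i = b 0 j) ->
  (O *m diag_mx a *m O^T) *m Y = Y *m (O *m diag_mx a *m O^T) ->
  (O *m diag_mx b *m O^T) *m Y = Y *m (O *m diag_mx b *m O^T).
Proof.
move=> oO ab; have OOt : O *m O^T = 1%:M by apply: mulmx1C.
have conj c : (O *m diag_mx c *m O^T) *m Y = Y *m (O *m diag_mx c *m O^T) <->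
    diag_mx c *m (O^T *m Y *m O) = (O^T *m Y *m O) *m diag_mx c.
  split=> [/(congr1 (fun M => O^T *m M *m O))|/(congr1 (fun M => O *m M *m O^T))].
    by rewrite !mulmxA oO mul1mx -!mulmxA oO mulmx1.
  by rewrite !mulmxA OOt mul1mx -!mulmxA OOt mulmx1.
rewrite !conj; move: (_ *m Y *m O) => Z eqZ; apply/matrixP => i j.
have := congr1 (fun M : 'M_d => M i j) eqZ.
rewrite !mul_mx_diag !mul_diag_mx !mxE => /eqP.
rewrite [Z i j * _]mulrC -subr_eq0 -mulrBl mulf_eq0 subr_eq0.
by case/orP => [/eqP/ab ->|/eqP ->]; rewrite ?mulr0 ?mul0r // mulrC.
Qed.

Lemma orth_diag_fixed k (O : 'M[R]_d) (a : 'rV_d) (Y : 'M_(d, k)) : O^T *m O = 1%:M ->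
  (O *m diag_mx a *m O^T) *m Y = Y <->
  (forall i j, (O^T *m Y) i j != 0 -> a 0 i = 1).
Proof.
move=> oO; have OOt : O *m O^T = 1%:M by apply: mulmx1C.
have -> : (O *m diag_mx a *m O^T) *m Y = Y <->
    diag_mx a *m (O^T *m Y) = O^T *m Y.
  split=> [{2}<-|e]; first by rewrite -!mulmxA orth_mulKmx.
  by rewrite -!mulmxA e mulmxA OOt mul1mx.
split=> [/matrixP e i j nz|e].
  by have := e i j; rewrite mul_diag_mx mxE -[X in _ = X]mul1r => /(mulIf nz).
apply/matrixP => i j; rewrite mul_diag_mx mxE.
by have [->|/e ->] := eqVneq ((O^T *m Y) i j) 0; rewrite ?mulr0 ?mul1r.
Qed.

(* V^T X is the positive square root of X^T X; only the two consequences of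
   positivity needed to identify its blocks are stated. *)
Lemma polar_commutant (I : Type) (g : I -> 'M[R]_d) (X : 'M[R]_d) :
  (forall i, (g i)^T *m g i = 1%:M) -> commutant g X ->
  exists2 V, orth_commutant g V &
   [/\ (V^T *m X)^T = V^T *m X,
       (forall Y : 'M_d, (X^T *m X) *m Y = Y *m (X^T *m X) ->
          (V^T *m X) *m Y = Y *m (V^T *m X))
     & (forall k (Y : 'M_(d, k)), (X^T *m X) *m Y = Y -> (V^T *m X) *m Y = Y)].
Proof.
move=> og cX; have c0 : commutant g 0 by move=> i; rewrite mulmx0 mul0mx.
have [U [oU cU] /=] := critical_point og c0 c0 cX (trmx0 _ _ _) (trmx0 _ _ _).
rewrite !mul0mx scaler0 add0r => symN; have [O oO [a defN]] := spectral_real symN.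
have UUt : U *m U^T = 1%:M by apply: mulmx1C.
(* The critical point only makes [X^T U] symmetric; multiplying [U] by the signs of the eigenvalues
   makes them nonnegative. The value 1 at eigenvalue 0 keeps [S] orthogonal, and [S] stays in the
   commutant as a function of [X^T U]. *)
pose s : 'rV[R]_d := \row_i (if a 0 i < 0 then -1 else 1).
pose S := O *m diag_mx s *m O^T.
have cS : commutant g S.
  move=> i; apply/esym/(@orth_diag_commute _ a) => //.
    by move=> k l; rewrite !mxE => ->.
  rewrite -defN; apply/esym/commutantM => //; exact: commutant_tr.
have SS : S *m S = 1%:M.
  rewrite mul_orth_diag // (_ : \row_i _ = const_mx 1) ?diag_const_mx ?mulmx1.
    exact: mulmx1C.
  by apply/rowP => i; rewrite !mxE; case: ifP; rewrite ?mulrNN mulr1.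
have XX : X^T *m X = O *m diag_mx (\row_i (a 0 i * a 0 i)) *m O^T.
  rewrite -mul_orth_diag // -defN -{2}symN trmx_mul trmxK.
  by rewrite mulmxA -(mulmxA X^T) UUt mulmx1.
have VX : (U *m S)^T *m X = O *m diag_mx (\row_i (s 0 i * a 0 i)) *m O^T.
  rewrite -mul_orth_diag // -defN -/S trmx_mul tr_orth_diag -mulmxA -symN.
  by rewrite (trmx_mul X^T) trmxK /S !mulmxA.
(* The eigenvalues [|a i|] of the new factor are functions of those of [X^T X], namely [a i ^ 2],
   and equal 1 when the latter do. *)
have sa i : (\row_i (s 0 i * a 0 i)) 0 i = `|a 0 i|.
  by rewrite !mxE; case: ltP => [/ltr0_norm ->|/ger0_norm ->]; rewrite ?mulN1r ?mul1r.
exists (U *m S).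
  by apply: orth_commutantM => //; split=> //; rewrite tr_orth_diag.
rewrite VX XX; split=> [|Y|k Y]; first exact: tr_orth_diag.
  apply: orth_diag_commute => // i j; rewrite !sa !mxE -!expr2 => /eqP.
  rewrite -[a 0 i ^+ 2]real_normK ?num_real // -[a 0 j ^+ 2]real_normK ?num_real //.
  by rewrite eqrXn2 // => /eqP.
rewrite !orth_diag_fixed // => e i j /e; rewrite sa mxE -expr2 => /eqP.
by rewrite -real_normK ?num_real // sqrp_eq1 // => /eqP.
Qed.

End SpectralTheorem.

(** * Tensors as block circulant matrices *)

Section TensorAlgebra.

Variables (R : comNzRingType) (l : nat).
Implicit Types m n r : nat.

Lemma tprodE m n r (A : tensor R m n l.+1) (B : tensor R n r l.+1) k :
  (A *t B) k = \sum_j A (k - j) *m B j.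
Proof. by rewrite ffunE mul_mxblock_mxrow mxcolK. Qed.

(** The first block column lists the slices. Since [bcirc] also respects products and transposes,
    tensor identities reduce to matrix identities. *)
Lemma bcirc_inj m n : injective (@bcirc R m n l).
Proof.
move=> A B /(congr1 (fun M => submxblock M)) e; apply/ffunP => k.
by have := congr1 (fun M => M k 0) e; rewrite !mxblockK subr0.
Qed.

Lemma bcircM m n r (A : tensor R m n l.+1) (B : tensor R n r l.+1) :
  bcirc (A *t B) = bcirc A *m bcirc B.
Proof.
rewrite mul_mxblock; apply: eq_mxblock => i j; rewrite tprodE.
rewrite (reindex_inj (addIr (- j))); apply: eq_bigr => k _.
by rewrite opprB addrA subrK.
Qed.

Lemma bcircD m n (A B : tensor R m n l.+1) : bcirc (A + B) = bcirc A + bcirc B.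
Proof. by rewrite -mxblockD; apply: eq_mxblock => i j; rewrite ffunE. Qed.

Lemma bcircN m n (A : tensor R m n l.+1) : bcirc (- A) = - bcirc A.
Proof. by rewrite -mxblockN; apply: eq_mxblock => i j; rewrite ffunE. Qed.

Lemma bcirc0 m n : bcirc (0 : tensor R m n l.+1) = 0.
Proof. by rewrite -mxblock0; apply: eq_mxblock => i j; rewrite ffunE. Qed.

Lemma bcirc1 m : bcirc (tid R m l) = 1%:M.
Proof.
apply/mxblockP => i j; rewrite mxblockK ffunE subr_eq0 -mxdiagZ.
have [<-|neq_ij] := eqVneq i j; first by rewrite submxblock_diag.
by rewrite mxblockK (negPf neq_ij).
Qed.

Lemma bcirc_tr m n (A : tensor R m n l.+1) : bcirc (ttr A) = (bcirc A)^T.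
Proof.
by rewrite tr_mxblock; apply: eq_mxblock => i j; rewrite ffunE opprB.
Qed.

Definition bcircE := (bcircM, bcircD, bcircN, bcirc0, bcirc1, bcirc_tr).

Lemma tprodA m n r s (A : tensor R m n l.+1) (B : tensor R n r l.+1)
  (C : tensor R r s l.+1) : A *t (B *t C) = A *t B *t C.
Proof. by apply: bcirc_inj; rewrite !bcircE mulmxA. Qed.

Lemma tprod1t m n (A : tensor R m n l.+1) : tid R m l *t A = A.
Proof. by apply: bcirc_inj; rewrite !bcircE mul1mx. Qed.

Lemma tprodt1 m n (A : tensor R m n l.+1) : A *t tid R n l = A.
Proof. by apply: bcirc_inj; rewrite !bcircE mulmx1. Qed.

Lemma tprod0t m n r (A : tensor R n r l.+1) :
  (0 : tensor R m n l.+1) *t A = 0.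
Proof. by apply: bcirc_inj; rewrite !bcircE mul0mx. Qed.

Lemma tprodt0 m n r (A : tensor R m n l.+1) :
  A *t (0 : tensor R n r l.+1) = 0.
Proof. by apply: bcirc_inj; rewrite !bcircE mulmx0. Qed.

Lemma tprodDr m n r (A : tensor R m n l.+1) (B C : tensor R n r l.+1) :
  A *t (B + C) = A *t B + A *t C.
Proof. by apply: bcirc_inj; rewrite !bcircE mulmxDr. Qed.

Lemma tprodDl m n r (A B : tensor R m n l.+1) (C : tensor R n r l.+1) :
  (A + B) *t C = A *t C + B *t C.
Proof. by apply: bcirc_inj; rewrite !bcircE mulmxDl. Qed.

Lemma tprodtN m n r (A : tensor R m n l.+1) (B : tensor R n r l.+1) :
  A *t (- B) = - (A *t B).
Proof. by apply: bcirc_inj; rewrite !bcircE mulmxN. Qed.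

Lemma tprodNt m n r (A : tensor R m n l.+1) (B : tensor R n r l.+1) :
  (- A) *t B = - (A *t B).
Proof. by apply: bcirc_inj; rewrite !bcircE mulNmx. Qed.

Lemma ttrK m n : cancel (@ttr R m n l) (@ttr R n m l).
Proof. by move=> A; apply: bcirc_inj; rewrite !bcircE trmxK. Qed.

Lemma ttrM m n r (A : tensor R m n l.+1) (B : tensor R n r l.+1) :
  ttr (A *t B) = ttr B *t ttr A.
Proof. by apply: bcirc_inj; rewrite !bcircE trmx_mul. Qed.

Lemma ttr0 m n : ttr (0 : tensor R m n l.+1) = 0.
Proof. by apply: bcirc_inj; rewrite !bcircE trmx0. Qed.

Lemma ttr1 m : ttr (tid R m l) = tid R m l.
Proof. by apply: bcirc_inj; rewrite !bcircE trmx1. Qed.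

Lemma ttrN m n (A : tensor R m n l.+1) : ttr (- A) = - ttr A.
Proof. by apply: bcirc_inj; rewrite !bcircE linearN. Qed.

Lemma orthogonalt_left m (Q : tensor R m m l.+1) :
  ttr Q *t Q = tid R m l -> orthogonalt Q.
Proof.
move=> QQ; split=> //; apply: bcirc_inj; rewrite !bcircE.
by apply: mulmx1C; rewrite -!bcircE QQ.
Qed.

(* Multiplication by a single slice of identity type is the cyclic shift of
   slices, so a matrix commuting with all of these is block circulant. *)
Definition tshift m k : tensor R m m l.+1 := [ffun j => if j == k then 1%:M else 0].

Lemma tshiftM m n k (A : tensor R m n l.+1) i : (tshift m k *t A) i = A (i - k).
Proof.
rewrite tprodE (bigD1 (i - k)) //= ffunE opprB addrCA subrr addr0 eqxx mul1mx.
rewrite big1 ?addr0 // => j neq_j; rewrite ffunE ifN ?mul0mx //.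
by apply: contra neq_j => /eqP <-; rewrite opprB addrCA subrr addr0.
Qed.

Lemma tshift_orth m k : (bcirc (tshift m k))^T *m bcirc (tshift m k) = 1%:M.
Proof.
apply: mulmx1C; rewrite -!bcircE; congr bcirc; apply/ffunP => i.
rewrite tshiftM !ffunE opprB -subr_eq0 addrAC subrr sub0r oppr_eq0.
by case: eqP; rewrite ?trmx1 ?trmx0.
Qed.

Lemma tshift_commute m k (A : tensor R m m l.+1) :
  bcirc (tshift m k) *m bcirc A = bcirc A *m bcirc (tshift m k).
Proof.
rewrite -!bcircE; congr bcirc; apply/ffunP => i.
rewrite tshiftM tprodE (bigD1 k) //= ffunE eqxx mulmx1 big1 ?addr0 // => j neq_j.
by rewrite ffunE (negPf neq_j) mulmx0.
Qed.

Lemma tshift_commutant m (X : 'M[R]_(\sum_(k < l.+1) m)) :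
  (forall k, bcirc (tshift m k) *m X = X *m bcirc (tshift m k)) ->
  exists A : tensor R m m l.+1, X = bcirc A.
Proof.
move=> cX; exists [ffun i => submxblock X i 0]; apply/mxblockP => i k.
(* Block [(i, 0)] of the commutation with the shift by [k] says that blocks [(i - k, 0)] and
   [(i, k)] of [X] agree. *)
rewrite mxblockK ffunE; have := congr1 (fun M => submxblock M i 0) (cX k).
rewrite -[X]submxblockK !mul_mxblock !mxblockK.
rewrite (bigD1 (i - k)) //= ffunE opprB addrCA subrr addr0 eqxx mul1mx.
rewrite big1 ?addr0 => [->|j neq_j]; last first.
  rewrite ffunE ifN ?mul0mx //.
  by apply: contra neq_j => /eqP <-; rewrite opprB addrCA subrr addr0.
rewrite (bigD1 k) //= ffunE subr0 eqxx mulmx1 big1 ?addr0 // => j neq_j.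
by rewrite ffunE subr0 (negPf neq_j) mulmx0.
Qed.

End TensorAlgebra.

(** * Calculus of block tensors *)

Section BlockTensors.

Variables (R : comNzRingType) (l : nat).
Implicit Types m n r : nat.

Lemma sum_row_mx (I : finType) m n1 n2 (F : I -> 'M[R]_(m, n1)) (G : I -> 'M_(m, n2)) :
  \sum_i row_mx (F i) (G i) = row_mx (\sum_i F i) (\sum_i G i).
Proof.
by elim/big_rec3: _ => [|i A B C _ ->]; rewrite ?row_mx0 // add_row_mx.
Qed.

Lemma sum_col_mx (I : finType) m1 m2 n (F : I -> 'M[R]_(m1, n)) (G : I -> 'M_(m2, n)) :
  \sum_i col_mx (F i) (G i) = col_mx (\sum_i F i) (\sum_i G i).
Proof.
by elim/big_rec3: _ => [|i A B C _ ->]; rewrite ?col_mx0 // add_col_mx.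
Qed.

Lemma tprod_rowt m n r1 r2 (A : tensor R m n l.+1) (B : tensor R n r1 l.+1)
  (C : tensor R n r2 l.+1) : A *t rowt B C = rowt (A *t B) (A *t C).
Proof.
apply/ffunP => k; rewrite tprodE [RHS]ffunE !tprodE -sum_row_mx.
by apply: eq_bigr => j _; rewrite ffunE mul_mx_row.
Qed.

Lemma tprod_colt m1 m2 n r (A : tensor R m1 n l.+1) (B : tensor R m2 n l.+1)
  (C : tensor R n r l.+1) : colt A B *t C = colt (A *t C) (B *t C).
Proof.
apply/ffunP => k; rewrite tprodE [RHS]ffunE !tprodE -sum_col_mx.
by apply: eq_bigr => j _; rewrite ffunE mul_col_mx.
Qed.

Lemma tprod_row_col m n1 n2 r (A : tensor R m n1 l.+1) (B : tensor R m n2 l.+1)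
    (C : tensor R n1 r l.+1) (D : tensor R n2 r l.+1) :
  rowt A B *t colt C D = A *t C + B *t D.
Proof.
apply/ffunP => k; rewrite tprodE [RHS]ffunE !tprodE -big_split.
by apply: eq_bigr => j _; rewrite !ffunE mul_row_col.
Qed.

Lemma ttr_rowt m n1 n2 (A : tensor R m n1 l.+1) (B : tensor R m n2 l.+1) :
  ttr (rowt A B) = colt (ttr A) (ttr B).
Proof. by apply/ffunP => k; rewrite !ffunE tr_row_mx. Qed.

Lemma ttr_colt m1 m2 n (A : tensor R m1 n l.+1) (B : tensor R m2 n l.+1) :
  ttr (colt A B) = rowt (ttr A) (ttr B).
Proof. by apply/ffunP => k; rewrite !ffunE tr_col_mx. Qed.

Lemma blocktE m1 m2 n1 n2 (A11 : tensor R m1 n1 l.+1) (A12 : tensor R m1 n2 l.+1)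
    (A21 : tensor R m2 n1 l.+1) (A22 : tensor R m2 n2 l.+1) :
  blockt A11 A12 A21 A22 = colt (rowt A11 A12) (rowt A21 A22).
Proof. by apply/ffunP => k; rewrite !ffunE. Qed.

Lemma blocktEh m1 m2 n1 n2 (A11 : tensor R m1 n1 l.+1) (A12 : tensor R m1 n2 l.+1)
    (A21 : tensor R m2 n1 l.+1) (A22 : tensor R m2 n2 l.+1) :
  blockt A11 A12 A21 A22 = rowt (colt A11 A21) (colt A12 A22).
Proof. by apply/ffunP => k; rewrite !ffunE block_mxEh. Qed.

Lemma rowt_inj m n1 n2 (A B : tensor R m n1 l.+1) (C D : tensor R m n2 l.+1) :
  rowt A C = rowt B D -> A = B /\ C = D.
Proof.
move=> /ffunP e; split; apply/ffunP => k.
  by have := e k; rewrite !ffunE => /eq_row_mx[].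
by have := e k; rewrite !ffunE => /eq_row_mx[].
Qed.

Lemma colt_inj m1 m2 n (A B : tensor R m1 n l.+1) (C D : tensor R m2 n l.+1) :
  colt A C = colt B D -> A = B /\ C = D.
Proof.
move=> /ffunP e; split; apply/ffunP => k.
  by have := e k; rewrite !ffunE => /eq_col_mx[].
by have := e k; rewrite !ffunE => /eq_col_mx[].
Qed.

Lemma rowt_surj m n1 n2 (A : tensor R m (n1 + n2) l.+1) :
  exists B C, A = rowt B C.
Proof.
exists [ffun k => lsubmx (A k)], [ffun k => rsubmx (A k)].
by apply/ffunP => k; rewrite !ffunE hsubmxK.
Qed.

Lemma colt_surj m1 m2 n (A : tensor R (m1 + m2) n l.+1) :
  exists B C, A = colt B C.
Proof.
exists [ffun k => usubmx (A k)], [ffun k => dsubmx (A k)].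
by apply/ffunP => k; rewrite !ffunE vsubmxK.
Qed.

Lemma rowt0 m n1 n2 : rowt 0 0 = 0 :> tensor R m (n1 + n2) l.+1.
Proof. by apply/ffunP => k; rewrite !ffunE row_mx0. Qed.

Lemma colt0 m1 m2 n : colt 0 0 = 0 :> tensor R (m1 + m2) n l.+1.
Proof. by apply/ffunP => k; rewrite !ffunE col_mx0. Qed.

Lemma addt_row m n1 n2 (A B : tensor R m n1 l.+1) (C D : tensor R m n2 l.+1) :
  rowt A C + rowt B D = rowt (A + B) (C + D).
Proof. by apply/ffunP => k; rewrite !ffunE add_row_mx. Qed.

Lemma addt_col m1 m2 n (A B : tensor R m1 n l.+1) (C D : tensor R m2 n l.+1) :
  colt A C + colt B D = colt (A + B) (C + D).
Proof. by apply/ffunP => k; rewrite !ffunE add_col_mx. Qed.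

Lemma oppt_row m n1 n2 (A : tensor R m n1 l.+1) (C : tensor R m n2 l.+1) :
  - rowt A C = rowt (- A) (- C).
Proof. by apply/ffunP => k; rewrite !ffunE opp_row_mx. Qed.

Lemma oppt_col m1 m2 n (A : tensor R m1 n l.+1) (C : tensor R m2 n l.+1) :
  - colt A C = colt (- A) (- C).
Proof. by apply/ffunP => k; rewrite !ffunE opp_col_mx. Qed.

Lemma tid_block m n :
  tid R (m + n) l = colt (rowt (tid R m l) 0) (rowt 0 (tid R n l)).
Proof.
apply/ffunP => k; rewrite !ffunE; case: eqP => _; first exact: scalar_mx_block.
by rewrite !row_mx0 col_mx0.
Qed.

Lemma fdiagonal_block m n (A : tensor R m m l.+1) (B : tensor R m n l.+1)
    (C : tensor R n m l.+1) (D : tensor R n n l.+1) :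
  fdiagonal (colt (rowt A B) (rowt C D)) <->
  [/\ fdiagonal A, B = 0, C = 0 & fdiagonal D].
Proof.
split=> [dM|[dA -> -> dD] k]; last first.
  by rewrite !ffunE -/(block_mx _ _ _ _) is_diag_block_mx // dA dD !eqxx.
suff dk k : [&& B k == 0, C k == 0, is_diag_mx (A k) & is_diag_mx (D k)].
  split=> [k| | |k]; try (apply/ffunP => k; rewrite ffunE);
    by case/and4P: (dk k) => // /eqP ? /eqP ?.
by have := dM k; rewrite !ffunE -/(block_mx _ _ _ _) is_diag_block_mx.
Qed.

(** The product is a convolution over a commutative group, with slices that commute. *)
Lemma fdiagonal_commute m (A B : tensor R m m l.+1) :
  fdiagonal A -> fdiagonal B -> A *t B = B *t A.
Proof.
move=> dA dB; apply/ffunP => k; rewrite !tprodE (reindex_inj (subrI k)) /=.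
apply: eq_bigr => j _; rewrite opprB addrCA subrr addr0.
have /diag_mxP[a ->] := dA j; have /diag_mxP[b ->] := dB (k - j).
exact: diag_mxC.
Qed.

End BlockTensors.

(** * Diagonalization and polar decomposition of tensors *)

Section TensorSpectral.

Variables (R : realType) (l : nat).

(* Distinct real weights, so that commuting with them means being f-diagonal. *)
Definition tweights m : tensor R m m l.+1 :=
  [ffun k => if k == 0 then diag_mx (\row_i i%:R) else 0].

(** As a commutation property, f-diagonality passes to products and, through the polar
    decomposition, to square roots. *)
Lemma fdiagonal_commuteP m (A : tensor R m m l.+1) :
  fdiagonal A <-> A *t tweights m = tweights m *t A.
Proof.
split=> [dA|].
  apply: fdiagonal_commute => // k; rewrite ffunE.
  by case: eqP => _; rewrite ?diag_mx_is_diag ?mx0_is_diag.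
move=> /ffunP e k; have := e k; rewrite !tprodE.
rewrite (bigD1 0) //= [X in _ + X]big1 => [|j /negPf neq_j0]; last first.
  by rewrite ffunE neq_j0 mulmx0.
rewrite [RHS](bigD1 k) //= [X in _ = _ + X]big1 => [|j neq_jk]; last first.
  by rewrite ffunE subr_eq0 eq_sym (negPf neq_jk) mul0mx.
rewrite !ffunE subrr subr0 eqxx !addr0 mul_mx_diag mul_diag_mx => /matrixP eA.
apply/is_diag_mxP => i j neq_ij; have /eqP := eA i j; rewrite !mxE mulrC.
rewrite -subr_eq0 -mulrBl mulf_eq0 subr_eq0 eqr_nat => /orP[|/eqP //].
by rewrite eq_sym (negPf neq_ij).
Qed.

(** The commutant of the cyclic shifts consists of block circulant matrices, so the maximizer comes
    from a tensor. *)
Lemma tensor_eigen m (H : tensor R m m l.+1) : ttr H = H ->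
  exists2 W, orthogonalt W & fdiagonal (ttr W *t H *t W).
Proof.
move=> symH; have symJ : ttr (tweights m) = tweights m.
  apply/ffunP => k; rewrite !ffunE oppr_eq0.
  by case: eqP => _; rewrite ?tr_diag_mx ?trmx0.
have [||M [oM /tshift_commutant[W defM]]] := orth_commutant_eigen
    (@tshift_orth R l m) (fun k => tshift_commute k (tweights m))
    (fun k => tshift_commute k H).
- by rewrite -bcirc_tr symJ.
- by rewrite -bcirc_tr symH.
rewrite {}defM in oM *; rewrite -!bcircE => /bcirc_inj eJ; exists W.
  by apply: orthogonalt_left; apply: bcirc_inj; rewrite !bcircE.
exact/fdiagonal_commuteP.
Qed.

Lemma tensor_polar m (X : tensor R m m l.+1) :
  exists2 V, orthogonalt V &
   [/\ ttr (ttr V *t X) = ttr V *t X,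
       (forall Y : tensor R m m l.+1, (ttr X *t X) *t Y = Y *t (ttr X *t X) ->
          (ttr V *t X) *t Y = Y *t (ttr V *t X))
     & (forall k (Y : tensor R m k l.+1), (ttr X *t X) *t Y = Y ->
          (ttr V *t X) *t Y = Y)].
Proof.
have [M [oM /tshift_commutant[V defM]]] := polar_commutant
    (@tshift_orth R l m) (fun k => tshift_commute k X).
rewrite {}defM in oM *; rewrite -!bcircE => -[/bcirc_inj symH cH fH]; exists V.
  by apply: orthogonalt_left; apply: bcirc_inj; rewrite !bcircE.
split=> // [Y|k Y] e; apply: bcirc_inj; rewrite bcircM.
  by rewrite [RHS]bcircM; apply: cH; rewrite -!bcircM e.
by apply: fH; rewrite -bcircM e.
Qed.

Lemma polar_fdiagonal m (X : tensor R m m l.+1) : fdiagonal (ttr X *t X) ->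
  exists2 V, orthogonalt V &
   [/\ ttr (ttr V *t X) = ttr V *t X, fdiagonal (ttr V *t X)
     & (forall k (Y : tensor R m k l.+1), (ttr X *t X) *t Y = Y ->
          (ttr V *t X) *t Y = Y)].
Proof.
move=> /fdiagonal_commuteP cX; have [V oV [symH cH fH]] := tensor_polar X.
by exists V => //; split=> //; apply/fdiagonal_commuteP; apply: cH.
Qed.

End TensorSpectral.

(** * The decomposition *)

Section CSDecomposition.

Variables (R : realType) (l : nat).

Local Notation T m n := (tensor R m n l.+1).
Local Notation "1" := (tid R _ l) : ring_scope.

Lemma rowt_colt m1 m2 n1 n2 (A : T m1 n1) (B : T m2 n1) (C : T m1 n2) (D : T m2 n2) :
  rowt (colt A B) (colt C D) = colt (rowt A C) (rowt B D).
Proof. by rewrite -blocktE blocktEh. Qed.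

(* The order matters: products are split into rows of blocks first, and zero
   factors are simplified only in products that are completely split. *)
Ltac block_simpl := repeat first
  [ rewrite !(ttr_rowt, ttr_colt, ttr0, ttr1, ttrN)
  | rewrite !rowt_colt | rewrite !tprod_colt | rewrite !tprod_rowt
  | rewrite !tprod_row_col
  | rewrite !(tprod0t, tprodt0, tprod1t, tprodt1, tprodtN, tprodNt)
  | rewrite !(addt_row, addt_col, oppt_row, oppt_col)
  | rewrite !(addr0, add0r, oppr0) ].

Lemma fdiagonal1 m : fdiagonal (1 : T m m).
Proof.
by move=> k; rewrite ffunE; case: eqP => _; rewrite ?mx0_is_diag ?scalar_mx_is_diag.
Qed.

Lemma fdiagonal0 m n : fdiagonal (0 : T m n).
Proof. by move=> k; rewrite ffunE mx0_is_diag. Qed.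

Lemma fdiagonalM m (A B : T m m) :
  fdiagonal A -> fdiagonal B -> fdiagonal (A *t B).
Proof.
move=> /fdiagonal_commuteP cA /fdiagonal_commuteP cB; apply/fdiagonal_commuteP.
by rewrite -tprodA cB tprodA cA tprodA.
Qed.

Lemma fdiagonalB m (A B : T m m) :
  fdiagonal A -> fdiagonal B -> fdiagonal (A - B).
Proof.
move=> /fdiagonal_commuteP cA /fdiagonal_commuteP cB; apply/fdiagonal_commuteP.
by rewrite tprodDl tprodDr tprodtN tprodNt cA cB.
Qed.

(** Zero columns make [B] square. The polar factor of the padded tensor is f-diagonal, which kills
    the block under [S]. The clause on fixed tensors later locates the identity block of [D]. *)
Lemma polar_tall s q (B : T (s + q) s) : fdiagonal (ttr B *t B) ->
  exists2 V : T (s + q) (s + q), orthogonalt V &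
  exists S : T s s, [/\ fdiagonal S, ttr S = S, ttr V *t B = colt S 0
    & forall k (Y : T s k), (ttr B *t B) *t Y = Y -> S *t Y = Y].
Proof.
move=> dB; pose X : T (s + q) (s + q) := rowt B 0.
have XX : ttr X *t X = colt (rowt (ttr B *t B) 0) (rowt 0 0).
  by rewrite /X; block_simpl.
have [|V oV [symH dH fixX]] := @polar_fdiagonal _ _ _ X.
  by rewrite XX; apply/fdiagonal_block; split=> //; apply: fdiagonal0.
have [S [S' defVB]] := colt_surj (ttr V *t B).
have defH : ttr V *t X = colt (rowt S 0) (rowt S' 0).
  by rewrite tprod_rowt tprodt0 defVB -rowt_colt colt0.
rewrite {}defH in symH dH fixX; have [dS _ S'0 _] := (fdiagonal_block _ _ _ _).1 dH.
move: symH; block_simpl => /colt_inj[/rowt_inj[symS _] _].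
exists V => //; exists S; split=> //.
  by rewrite defVB S'0.
move=> k Y YB; have := fixX k (colt Y 0).
by rewrite XX; block_simpl; rewrite YB => /(_ erefl) /colt_inj[].
Qed.

(** [W] diagonalizes [B^T B]; the polar decomposition of [B W] then gives [V] and [S]. *)
Lemma svd_tall s q (B : T (s + q) s) :
  exists (V : T (s + q) (s + q)) (W S : T s s),
    [/\ orthogonalt V, orthogonalt W, fdiagonal S, ttr S = S
      & ttr V *t B *t W = colt S 0].
Proof.
have [|W oW dW] := @tensor_eigen _ _ _ (ttr B *t B); first by rewrite ttrM ttrK.
have [|V oV [S [dS symS VB _]]] := @polar_tall _ _ (B *t W).
  by rewrite ttrM -tprodA [ttr B *t _]tprodA tprodA.
by exists V, W, S; split; rewrite // -tprodA.
Qed.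

(** The transposed argument: [V] diagonalizes [B B^T], and the zero padding of [B^T V] is put on the
    left so that [S] ends in the last columns. *)
Lemma svd_wide s p (B : T s (p + s)) :
  exists (V : T s s) (W : T (p + s) (p + s)) (S : T s s),
    [/\ orthogonalt V, orthogonalt W, fdiagonal S, ttr S = S
      & ttr V *t B *t W = rowt 0 S].
Proof.
have [|V oV dV] := @tensor_eigen _ _ _ (B *t ttr B); first by rewrite ttrM ttrK.
pose X : T (p + s) (p + s) := rowt 0 (ttr B *t V).
have [|W oW [symH dH _]] := @polar_fdiagonal _ _ _ X.
  rewrite /X; block_simpl; apply/fdiagonal_block; split=> //; first exact: fdiagonal0.
  by rewrite ttrM ttrK -tprodA [B *t _]tprodA tprodA.
have [S' [S defWX]] := colt_surj (ttr W *t (ttr B *t V)).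
have defH : ttr W *t X = colt (rowt 0 S') (rowt 0 S).
  by rewrite tprod_rowt tprodt0 defWX -rowt_colt colt0.
rewrite {}defH in symH dH; have [_ S'0 _ dS] := (fdiagonal_block _ _ _ _).1 dH.
move: symH; block_simpl => /colt_inj[_ /rowt_inj[_ symS]].
exists V, W, S; split=> //.
have := congr1 (@ttr _ _ _ _) defWX.
by rewrite !ttrM !ttrK ttr_colt S'0 symS ttr0.
Qed.

Lemma svd_corner p s q (B : T (s + q) (p + s)) : p = 0%N \/ q = 0%N ->
  exists (V : T (s + q) (s + q)) (W : T (p + s) (p + s)) (S : T s s),
    [/\ orthogonalt V, orthogonalt W, fdiagonal S, ttr S = S
      & ttr V *t B *t W = colt (rowt 0 S) 0].
Proof.
case=> [p0|q0]; subst.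
  have [V [W [S [oV oW dS symS e]]]] := svd_tall B; exists V, W, S; split=> //.
  by rewrite e; congr colt; apply/ffunP => k; rewrite !ffunE row_thin_mx.
(* Here [q = 0], and [s + 0] equals [s] only propositionally: the row size is generalized so that
   the equation can be substituted. *)
have castW k (e : k = s) (A : T k (p + s)) :
    exists (V : T k k) (W : T (p + s) (p + s)) (S : T s s),
    [/\ orthogonalt V, orthogonalt W, fdiagonal S, ttr S = S
      & ttr V *t A *t W = castt (esym e, erefl) (rowt 0 S)].
  subst; have [V [W [S [oV oW dS symS e]]]] := svd_wide A; exists V, W, S.
  by split=> //; rewrite e; apply/ffunP => k; rewrite [RHS]ffunE castmx_id.
have [V [W [S [oV oW dS symS e]]]] := castW _ (addn0 s) B; exists V, W, S.
split=> //; rewrite e; apply/ffunP => k; rewrite [LHS]ffunE [RHS]ffunE.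
apply/matrixP => i j; rewrite castmxE !mxE.
by case: (splitP i) => [i' ei|[]//]; rewrite cast_ord_id; congr (_ _ _); apply: val_inj.
Qed.

(** The first [n1] columns of [D], with rows grouped as [m1 + m2]; [csd_right] holds the other [n2]
    columns. *)
Definition csd_left p s t q (C S : T s s) : T (p + s + t + (s + q)) (p + s) :=
  colt (colt (colt (rowt 1 0) (rowt 0 C)) 0) (colt (rowt 0 S) 0).

Definition csd_right p s t q (C S : T s s) :
    T (p + s + t + (s + q)) (s + (q + t)) :=
  colt (colt (colt (rowt 0 (rowt 0 0)) (rowt S (rowt 0 0))) (rowt 0 (rowt 0 1)))
       (colt (rowt (- C) (rowt 0 0)) (rowt 0 (rowt 1 0))).

(** The only block products that are not immediate are [S S + C C] and [C S - S C]. *)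
Lemma csd_right_unitary p s t q (C S : T s s) :
  ttr C = C -> ttr S = S -> C *t C + S *t S = 1 -> C *t S = S *t C ->
  ttr (csd_right p t q C S) *t csd_right p t q C S = 1 /\
  ttr (csd_left p t q C S) *t csd_right p t q C S = 0.
Proof.
move=> symC symS CCSS comCS; rewrite /csd_right /csd_left; split.
  block_simpl; rewrite !rowt0 opprK symC symS [S *t S + _]addrC CCSS -rowt_colt.
  by rewrite colt0 [RHS]tid_block [in RHS]tid_block.
block_simpl; rewrite !rowt0 symC symS !addr0 addt_col addt_row comCS subrr addr0.
by rewrite addr0 rowt0 colt0.
Qed.

Lemma csd_block p s t q (Q1 : T (p + s + t) (p + s)) (Q2 : T (p + s + t) (s + (q + t)))
    (Q3 : T (s + q) (p + s)) (Q4 : T (s + q) (s + (q + t))) :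
  p = 0%N \/ q = 0%N ->
  ttr (blockt Q1 Q2 Q3 Q4) *t blockt Q1 Q2 Q3 Q4 = 1 ->
  blockt Q1 Q2 Q3 Q4 *t ttr (blockt Q1 Q2 Q3 Q4) = 1 ->
  exists (U : T (p + s + t) (p + s + t)) (V : T (s + q) (s + q))
         (W : T (p + s) (p + s)) (Z : T (s + (q + t)) (s + (q + t))) (C S : T s s),
    [/\ orthogonalt U, orthogonalt V, orthogonalt W & orthogonalt Z] /\
    [/\ fdiagonal C, fdiagonal S, ttr C *t C + ttr S *t S = 1
      & ttr (blockt U 0 0 V) *t blockt Q1 Q2 Q3 Q4 *t blockt W 0 0 Z =
        rowt (csd_left p t q C S) (csd_right p t q C S)].
Proof.
move=> pq0; rewrite blocktEh; set L := colt Q1 Q3; set M := colt Q2 Q4.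
rewrite ttr_rowt tprod_row_col tprod_colt !tprod_rowt => QQ QQt.
have LL : ttr L *t L = 1.
  by move: QQ; rewrite tid_block => /colt_inj[/rowt_inj[]].
have [V [W [S [oV oW dS symS defS]]]] := svd_corner Q3 pq0.
have [[oV1 oV2] [oW1 oW2]] := (oV, oW).
have SS : ttr (Q3 *t W) *t (Q3 *t W) = colt 0 (rowt 0 (S *t S)).
  have -> : Q3 *t W = V *t colt (rowt 0 S) 0 by rewrite -defS !tprodA oV2 tprod1t.
  rewrite ttrM -tprodA [ttr V *t _]tprodA oV1 tprod1t; block_simpl.
  by rewrite symS rowt0.
(* The first block column of [Q] is isometric, so the Gram tensor of [Q1 W] is 1 minus that of
   [Q3 W], again f-diagonal; its polar decomposition yields [U]. *)
have QW : ttr (Q1 *t W) *t (Q1 *t W) = colt (rowt 1 0) (rowt 0 (1 - S *t S)).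
  have : ttr (Q1 *t W) *t (Q1 *t W) + ttr (Q3 *t W) *t (Q3 *t W) = 1.
    rewrite !ttrM -!tprodA -tprodDr ![ttr _ *t (_ *t W)]tprodA -tprodDl.
    by rewrite -tprod_row_col -ttr_colt LL tprod1t.
  rewrite SS => /(canRL (addrK _)) ->; rewrite tid_block -(@rowt0 R l p p s).
  by block_simpl.
have [|U oU [C' [dC' symC' defC' fixC']]] := @polar_tall _ _ (Q1 *t W).
  rewrite QW; apply/fdiagonal_block; split=> //; first exact: fdiagonal1.
  by apply: fdiagonalB (fdiagonal1 _) _; apply: fdiagonalM.
have [oU1 oU2] := oU.
have [A [C [dC defC1]]] : exists A C, fdiagonal C /\ C' = colt (rowt A 0) (rowt 0 C).
  have [B1 [B2 eB]] := colt_surj C'; have [A [B eA]] := rowt_surj B1.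
  have [D [C eC]] := rowt_surj B2; exists A, C; move: dC'; rewrite eB eA eC.
  by move=> /fdiagonal_block[_ -> -> dC].
have {A defC1} defC1 : C' = colt (rowt 1 0) (rowt 0 C).
  (* The Gram tensor fixes the first [p] coordinate directions, hence so does its square root
     [C']. *)
  have := fixC' _ (colt 1 0); rewrite QW defC1; block_simpl => /(_ erefl).
  by move=> /colt_inj[-> _].
have symC : ttr C = C.
  by move: symC'; rewrite defC1; block_simpl => /colt_inj[_ /rowt_inj[]].
have CCSS : C *t C + S *t S = 1.
  have : ttr (Q1 *t W) *t (Q1 *t W) = ttr C' *t C'.
    have -> : Q1 *t W = U *t colt C' 0 by rewrite -defC' !tprodA oU2 tprod1t.
    rewrite ttrM -tprodA [ttr U *t _]tprodA oU1 tprod1t ttr_colt ttr0.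
    by rewrite tprod_row_col tprod0t addr0.
  rewrite QW defC1; block_simpl => /colt_inj[_ /rowt_inj[_ e]].
  by rewrite symC in e; rewrite -e subrK.
have [TT ET] := csd_right_unitary p t q symC symS CCSS (fdiagonal_commute dC dS).
set P := blockt U 0 0 V; set E := csd_left p t q C S in ET *.
set F := csd_right p t q C S in TT ET *.
have PP : ttr P *t P = 1.
  by rewrite /P blocktE; block_simpl; rewrite oU1 oV1 [RHS]tid_block.
have PLW : ttr P *t L *t W = E.
  by rewrite /P /L blocktE; block_simpl; rewrite -tprodA defC' defS defC1.
pose Y := ttr P *t M.
(* [Q Q^T = 1] gives [E E^T + Y Y^T = 1]; applied to [F], which is orthogonal to [E], this leaves
   [Y Y^T F = F]. Thus [Z = Y^T F] sends [Y] to [F], and [Z^T Z = F^T F = 1]. *)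
have YF : Y *t (ttr Y *t F) = F.
  have EE : ttr P *t L *t (ttr L *t P) = E *t ttr E.
    rewrite -PLW [ttr (_ *t W)]ttrM -(tprodA _ W) (tprodA W) oW2 tprod1t.
    by rewrite ttrM ttrK.
  have : E *t ttr E + Y *t ttr Y = 1.
    rewrite -EE /Y [ttr (_ *t M)]ttrM ttrK -!tprodA -tprodDr !tprodA -tprodDl.
    by rewrite QQt tprod1t.
  by rewrite tprodA => /(canRL (addKr _)) ->; rewrite tprodDl tprodNt tprod1t
     -tprodA ET tprodt0 oppr0 add0r.
have oZ : orthogonalt (ttr Y *t F).
  by apply: orthogonalt_left; rewrite ttrM ttrK -tprodA YF TT.
exists U, V, W, (ttr Y *t F), C, S; do 2![split=> //].
  by rewrite symC symS.
rewrite -/P tprod_rowt blocktE tprod_row_col !tprod_rowt !tprodt0 PLW YF.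
by rewrite addt_row addr0 add0r.
Qed.

End CSDecomposition.

(** * Changes of index sizes *)

Section Casts.

Variables (R : realType) (l : nat).

(** Orthogonality is restated without casts, so that row and column sizes may then be rewritten
    independently. *)
Lemma castt_rect_orthogonal m n (e : n = m) (Q : tensor R m n l.+1) :
  orthogonalt (castt (erefl, e) Q) ->
  ttr Q *t Q = tid R n l /\ Q *t ttr Q = tid R m l.
Proof.
subst m; rewrite (_ : castt _ Q = Q) => [[]//|].
by apply/ffunP => k; rewrite ffunE castmx_id.
Qed.

Lemma castt_comp m n m' n' (em : m = m') (en : n = n') (A : tensor R m n l.+1) :
  castt (em, en) A = castt (em, erefl) (castt (erefl, en) A).
Proof.
by subst m' n'; apply/ffunP => k; rewrite [LHS]ffunE [RHS]ffunE castmx_id ffunE.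
Qed.

Lemma castt_colt m1 m2 n n' (e : n = n') (A : tensor R m1 n l.+1)
    (B : tensor R m2 n l.+1) :
  castt (erefl, e) (colt A B) = colt (castt (erefl, e) A) (castt (erefl, e) B).
Proof.
by subst n'; apply/ffunP => k; rewrite [LHS]ffunE castmx_id !ffunE !castmx_id.
Qed.

Lemma rowtA m n1 n2 n3 (e : (n1 + (n2 + n3) = n1 + n2 + n3)%N)
    (A : tensor R m n1 l.+1) (B : tensor R m n2 l.+1) (C : tensor R m n3 l.+1) :
  castt (erefl, e) (rowt A (rowt B C)) = rowt (rowt A B) C.
Proof.
apply/ffunP => k; rewrite [LHS]ffunE !ffunE row_mxA.
by rewrite castmx_comp castmx_id.
Qed.

Lemma coltA m1 m2 m3 m4 n
    (e : (m1 + (m2 + (m3 + m4)) = m1 + m2 + m3 + m4)%N)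
    (A : tensor R m1 n l.+1) (B : tensor R m2 n l.+1) (C : tensor R m3 n l.+1)
    (D : tensor R m4 n l.+1) :
  castt (e, erefl) (colt A (colt B (colt C D))) = colt (colt (colt A B) C) D.
Proof.
apply/ffunP => k; rewrite [LHS]ffunE !ffunE !col_mxA.
by rewrite !castmx_comp castmx_id.
Qed.

Lemma csd_tensor_cast p s t q (C S : tensor R s s l.+1)
    (er : (p + (s + (t + (s + q))) = p + s + t + (s + q))%N)
    (ec : (p + (s + (s + (q + t))) = p + s + (s + (q + t)))%N) :
  castt (er, ec) (csd_tensor p t q C S) =
  rowt (csd_left p t q C S) (csd_right p t q C S).
Proof.
rewrite castt_comp /csd_tensor !castt_colt !rowtA coltA.
by rewrite /csd_left /csd_right !rowt_colt -!(rowt0 R l _ p s).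
Qed.

End Casts.

Theorem theorem3p2 (R : realType) (m1 m2 n1 n2 n : nat)
    (m1_gt0 : (0 < m1)%N) (m2_gt0 : (0 < m2)%N)
    (n1_gt0 : (0 < n1)%N) (n2_gt0 : (0 < n2)%N)
    (eq_mn : (m1 + m2)%N = (n1 + n2)%N)
    (le_n1m1 : (n1 <= m1)%N) (le_m2m1 : (m2 <= m1)%N)
    (Q11 : tensor R m1 n1 n.+1) (Q12 : tensor R m1 n2 n.+1)
    (Q21 : tensor R m2 n1 n.+1) (Q22 : tensor R m2 n2 n.+1)
    (Q : tensor R (m1 + m2) (n1 + n2) n.+1)
    (defQ : Q = blockt Q11 Q12 Q21 Q22)
    (orthQ : orthogonalt (castt (erefl, esym eq_mn) Q)) :
  let p := (n1 - m2)%N in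
  let q := (m2 - n1)%N in
  exists (U : tensor R m1 m1 n.+1) (V : tensor R m2 m2 n.+1)
         (W : tensor R n1 n1 n.+1) (Z : tensor R n2 n2 n.+1)
         (C S : tensor R (n1 - p) (n1 - p) n.+1),
    [/\ orthogonalt U, orthogonalt V, orthogonalt W & orthogonalt Z] /\
    [/\ fdiagonal C, fdiagonal S,
        ttr C *t C + ttr S *t S = tid R (n1 - p) n
      & ttr (blockt U 0 0 V) *t Q *t blockt W 0 0 Z =
        castt (csd_row_dim m2 le_n1m1, csd_col_dim eq_mn le_n1m1)
              (csd_tensor p (m1 - n1) q C S)].
Proof.
move=> p q.
(* The size proofs become variables, so that the casts survive the substitutions below. *)
move: (csd_row_dim m2 le_n1m1) (csd_col_dim eq_mn le_n1m1).
have pq0 : p = 0%N \/ q = 0%N by rewrite /p /q; lia.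
(* All sizes are expressed through [p], [s = n1 - p], [t = m1 - n1] and [q], which are then
   generalized to independent variables. *)
have defn1 : n1 = (p + (n1 - p))%N by rewrite /p; lia.
have defm2 : m2 = ((n1 - p) + q)%N by rewrite /p /q; lia.
have defm1 : m1 = (p + (n1 - p) + (m1 - n1))%N by rewrite /p; lia.
have defn2 : n2 = ((n1 - p) + (q + (m1 - n1)))%N by rewrite /p /q; lia.
move: (castt_rect_orthogonal orthQ) => {orthQ} [].
rewrite {}defQ -/p -/q.
move: (n1 - p)%N (m1 - n1)%N pq0 defn1 defm2 defm1 defn2.
move: p q => p q s t pq0 defn1 defm2 defm1 defn2 QQ QQt er ec.
clear eq_mn le_n1m1 le_m2m1 m1_gt0 m2_gt0 n1_gt0 n2_gt0 Q.
subst n1 n2 m1 m2.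
have [U [V [W [Z [C [S [oUVWZ [dC dS CS e]]]]]]]] := csd_block pq0 QQ QQt.
exists U, V, W, Z, C, S; split=> //; split=> //.
by rewrite e csd_tensor_cast.
Qed.
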